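(* Let $\mathcal C$ be an abelian monoidal category and let $(H,\Delta,\varepsilon)$ be a coalgebra in $\mathcal C$ which is left flat. Then every geometric partial $H$-comodule in $\mathcal C$ is globalizable; that is, the full subcategory of globalizable geometric partial $H$-comodules coincides with the category of all geometric partial $H$-comodules.
   Context: $(\mathcal C,\otimes,\mathbb I)$ is a locally small monoidal category (written as if strict) whose underlying category is abelian. The identity of an object $X$ is again denoted $X$. A coalgebra $H$ is left flat if the endofunctor $-\otimes H:\mathcal C\to\mathcal C$ preserves equalizers. $\mathsf{Com}^H$ denotes the category of (global, i.e. coassociative counital) right $H$-comodules $(Y,\delta_Y)$. A partial comodule datum over $H$ is $(X,X\bullet H,\pi_X,\rho_X)$ with $\rho_X:X\to X\bullet H$ a morphism and $\pi_X:X\otimes H\to X\bullet H$ an epimorphism. Let $(X\bullet H)\bullet H$, with morphisms $\rho_X\bullet H:X\bullet H\to (X\bullet H)\bullet H$ and $\pi_{X\bullet H}:(X\bullet H)\otimes H\to (X\bullet H)\bullet H$, be the pushout of $\pi_X:X\otimes H\to X\bullet H$ and $\rho_X\otimes H:X\otimes H\to (X\bullet H)\otimes H$. Let $X\bullet(H\bullet H)$, with morphisms $X\bullet\Delta:X\bullet H\to X\bullet(H\bullet H)$ and $\pi_{X,\Delta}:(X\bullet H)\otimes H\to X\bullet(H\bullet H)$, be the pushout of $\pi_X$ and $(\pi_X\otimes H)\circ(X\otimes\Delta):X\otimes H\to (X\bullet H)\otimes H$. The datum is a geometric partial comodule if: (GPC1, counitality) there is a morphism $X\bullet\varepsilon:X\bullet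 H\to X$ with $(X\bullet\varepsilon)\circ\rho_X=\mathrm{Id}_X$ and $(X\bullet\varepsilon)\circ\pi_X=X\otimes\varepsilon$; (GPC2, geometric coassociativity) there is an isomorphism $\theta:X\bullet(H\bullet H)\to (X\bullet H)\bullet H$ with $\theta\circ\pi_{X,\Delta}=\pi_{X\bullet H}$ and $\theta\circ(X\bullet\Delta)\circ\rho_X=(\rho_X\bullet H)\circ\rho_X$. A globalization of a geometric partial comodule $X$ is a global $H$-comodule $(Y,\delta)$ with a morphism $p:Y\to X$ in $\mathcal C$ such that: (GL1) $\rho_X\circ p=\pi_X\circ(p\otimes H)\circ\delta$; (GL2) for every global $H$-comodule $(Z,\delta_Z)$, $\eta\mapsto p\circ\eta$ is a bijection from $\mathsf{Com}^H(Z,Y)$ onto the set of morphisms $f:Z\to X$ in $\mathcal C$ with $\rho_X\circ f=\pi_X\circ(f\otimes H)\circ\delta_Z$; (GL3) the commutative square in (GL1) exhibits $(X\bullet H,\rho_X,\pi_X)$ as the pushout in $\mathcal C$ of $p:Y\to X$ and $(p\otimes H)\circ\delta:Y\to X\otimes H$. $X$ is globalizable if a globalization exists. *)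

(* Defs.v *)
From mathcomp Require Import all_boot ssralg.
From mathcomp Require Import boolp classical_sets functions.

Set Implicit Arguments.
Unset Strict Implicit.
Unset Printing Implicit Defensive.

Import GRing.Theory.

Declare Scope cat_scope.
Delimit Scope cat_scope with cat.
Local Open Scope classical_set_scope.
Local Open Scope cat_scope.

Record category := Category {
  obj :> Type;
  hom : obj -> obj -> Type;
  idm : forall x, hom x x;
  compm : forall x y z, hom y z -> hom x y -> hom x z;
  compm1l : forall x y (f : hom x y), compm (idm y) f = f;
  compm1r : forall x y (f : hom x y), compm f (idm x) = f;
  compmA : forall x y z t (f : hom z t) (g : hom y z) (h : hom x y),
    compm f (compm g h) = compm (compm f g) h
}.

Arguments hom {c} x y.
Arguments idm {c} x.
Arguments compm {c x y z} f g.

Notation "g ∘ f" := (compm g f) (at level 40, left associativity) : cat_scope.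

Section Limits.
Variable C : category.

Definition mono (x y : C) (f : hom x y) : Prop :=
  forall z (g h : hom z x), f ∘ g = f ∘ h -> g = h.

Definition epi (x y : C) (f : hom x y) : Prop :=
  forall z (g h : hom y z), g ∘ f = h ∘ f -> g = h.

Definition iso (x y : C) (f : hom x y) : Prop :=
  exists g : hom y x, g ∘ f = idm x /\ f ∘ g = idm y.

Definition is_zero_object (z : C) : Prop :=
  forall x : C,
    (exists f : hom z x, forall g, g = f) /\
    (exists f : hom x z, forall g, g = f).

Definition is_equalizer (x y : C) (f g : hom x y) (e : C) (k : hom e x) : Prop :=
  f ∘ k = g ∘ k /\
  forall t (u : hom t x), f ∘ u = g ∘ u -> exists! v : hom t e, k ∘ v = u.

Definition is_coequalizer (x y : C) (f g : hom x y) (q : C) (c : hom y q) : Prop :=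
  c ∘ f = c ∘ g /\
  forall t (u : hom y t), u ∘ f = u ∘ g -> exists! v : hom q t, v ∘ c = u.

Definition is_pushout (s x y : C) (f : hom s x) (g : hom s y)
    (p : C) (i : hom x p) (j : hom y p) : Prop :=
  i ∘ f = j ∘ g /\
  forall t (u : hom x t) (v : hom y t), u ∘ f = v ∘ g ->
    exists! w : hom p t, w ∘ i = u /\ w ∘ j = v.

Record pushout (s x y : C) (f : hom s x) (g : hom s y) := Pushout {
  po_obj :> C;
  po_inl : hom x po_obj;
  po_inr : hom y po_obj;
  pushoutP : is_pushout f g po_inl po_inr
}.

End Limits.

Record preadditive (C : category) := Preadditive {
  hom_Zmodule : forall x y : C, GRing.Zmodule (hom x y);
  hom_zmod := fun x y : C => GRing.Zmodule.Pack (hom_Zmodule x y);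
  compmDl : forall (x y z : C) (f g : hom_zmod y z) (h : hom x y),
    (f + g)%R ∘ h = ((f ∘ h : hom_zmod x z) + (g ∘ h : hom_zmod x z))%R;
  compmDr : forall (x y z : C) (f : hom y z) (g h : hom_zmod x y),
    f ∘ (g + h)%R = ((f ∘ g : hom_zmod x z) + (f ∘ h : hom_zmod x z))%R
}.

Section Additive.
Variables (C : category) (A : preadditive C).

Definition zero_mor (x y : C) : hom x y := (0 : hom_zmod A x y)%R.

Definition add_mor (x y : C) (f g : hom x y) : hom x y :=
  ((f : hom_zmod A x y) + (g : hom_zmod A x y))%R.

Definition is_biproduct (x y p : C) (i1 : hom x p) (i2 : hom y p)
    (q1 : hom p x) (q2 : hom p y) : Prop :=
  [/\ q1 ∘ i1 = idm x, q2 ∘ i2 = idm y,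
      q1 ∘ i2 = zero_mor y x, q2 ∘ i1 = zero_mor x y &
      add_mor (i1 ∘ q1) (i2 ∘ q2) = idm p].

Definition is_kernel (x y : C) (f : hom x y) (e : C) (k : hom e x) : Prop :=
  is_equalizer f (zero_mor x y) k.

Definition is_cokernel (x y : C) (f : hom x y) (q : C) (c : hom y q) : Prop :=
  is_coequalizer f (zero_mor x y) c.

End Additive.

Record abelian (C : category) := Abelian {
  abelian_preadditive :> preadditive C;
  abelian_zero : exists z : C, is_zero_object z;
  abelian_biproduct : forall x y : C,
    exists (p : C) (i1 : hom x p) (i2 : hom y p) (q1 : hom p x) (q2 : hom p y),
      is_biproduct abelian_preadditive i1 i2 q1 q2;
  abelian_kernel : forall (x y : C) (f : hom x y),
    exists (e : C) (k : hom e x), is_kernel abelian_preadditive f k;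
  abelian_cokernel : forall (x y : C) (f : hom x y),
    exists (q : C) (c : hom y q), is_cokernel abelian_preadditive f c;
  abelian_mono : forall (x y : C) (f : hom x y), mono f ->
    exists (z : C) (g : hom y z), is_kernel abelian_preadditive g f;
  abelian_epi : forall (x y : C) (f : hom x y), epi f ->
    exists (z : C) (g : hom z x), is_cokernel abelian_preadditive g f
}.

(* Not assumed strict: [assoc], [lunit], [runit] are the structural
   isomorphisms; [assocV] is the inverse of [assoc].  No additivity or
   exactness of the tensor product is required. *)
Record monoidal_category := MonoidalCategory {
  mon_cat :> category;
  tens : mon_cat -> mon_cat -> mon_cat;
  tensm : forall x x' y y' : mon_cat,
    hom x x' -> hom y y' -> hom (tens x y) (tens x' y');
  unit_obj : mon_cat;
  assoc : forall x y z : mon_cat, hom (tens (tens x y) z) (tens x (tens y z));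
  assocV : forall x y z : mon_cat, hom (tens x (tens y z)) (tens (tens x y) z);
  lunit : forall x : mon_cat, hom (tens unit_obj x) x;
  runit : forall x : mon_cat, hom (tens x unit_obj) x;
  tensm1 : forall x y : mon_cat, tensm (idm x) (idm y) = idm (tens x y);
  tensm_comp : forall (x x' x'' y y' y'' : mon_cat)
      (f' : hom x' x'') (f : hom x x') (g' : hom y' y'') (g : hom y y'),
    tensm (f' ∘ f) (g' ∘ g) = tensm f' g' ∘ tensm f g;
  assocK : forall x y z, assocV x y z ∘ assoc x y z = idm (tens (tens x y) z);
  assocVK : forall x y z, assoc x y z ∘ assocV x y z = idm (tens x (tens y z));
  lunit_iso : forall x, iso (lunit x);
  runit_iso : forall x, iso (runit x);
  assoc_nat : forall (x x' y y' z z' : mon_cat)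
      (f : hom x x') (g : hom y y') (h : hom z z'),
    assoc x' y' z' ∘ tensm (tensm f g) h = tensm f (tensm g h) ∘ assoc x y z;
  lunit_nat : forall (x y : mon_cat) (f : hom x y),
    lunit y ∘ tensm (idm unit_obj) f = f ∘ lunit x;
  runit_nat : forall (x y : mon_cat) (f : hom x y),
    runit y ∘ tensm f (idm unit_obj) = f ∘ runit x;
  pentagon : forall x y z t : mon_cat,
    tensm (idm x) (assoc y z t) ∘ assoc x (tens y z) t ∘ tensm (assoc x y z) (idm t)
    = assoc x y (tens z t) ∘ assoc (tens x y) z t;
  triangle : forall x y : mon_cat,
    tensm (idm x) (lunit y) ∘ assoc x unit_obj y = tensm (runit x) (idm y)
}.

Arguments tens {m} x y.
Arguments tensm {m x x' y y'} f g.
Arguments unit_obj {m}.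
Arguments assoc {m} x y z.
Arguments assocV {m} x y z.
Arguments lunit {m} x.
Arguments runit {m} x.

Notation "x ⊗ y" := (tens x y) (at level 38, left associativity) : cat_scope.
Notation "f ⊠ g" := (tensm f g) (at level 38, left associativity) : cat_scope.

Record coalgebra (C : monoidal_category) := Coalgebra {
  coalg_obj :> C;
  comul : hom coalg_obj (coalg_obj ⊗ coalg_obj);
  counit : hom coalg_obj unit_obj;
  comulA : assoc _ _ _ ∘ (comul ⊠ idm coalg_obj) ∘ comul
           = (idm coalg_obj ⊠ comul) ∘ comul;
  counitl : lunit _ ∘ (counit ⊠ idm coalg_obj) ∘ comul = idm coalg_obj;
  counitr : runit _ ∘ (idm coalg_obj ⊠ counit) ∘ comul = idm coalg_obj
}.

Arguments comul {C} c.
Arguments counit {C} c.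

Section Comodules.
Variables (C : monoidal_category) (H : coalgebra C).

Definition left_flat : Prop :=
  forall (x y : C) (f g : hom x y) (e : C) (k : hom e x),
    is_equalizer f g k ->
    is_equalizer (f ⊠ idm H) (g ⊠ idm H) (k ⊠ idm H).

Record comodule := Comodule {
  com_obj :> C;
  coact : hom com_obj (com_obj ⊗ H);
  coactA : assoc _ _ _ ∘ (coact ⊠ idm H) ∘ coact
           = (idm com_obj ⊠ comul H) ∘ coact;
  coact_counit : runit _ ∘ (idm com_obj ⊠ counit H) ∘ coact = idm com_obj
}.

Definition is_comodule_mor (Z Y : comodule) (f : hom Z Y) : Prop :=
  coact Y ∘ f = (f ⊠ idm H) ∘ coact Z.

Record partial_comodule_datum := PartialComoduleDatum {
  pcom_obj :> C;
  pcom_bullet : C; (* X • H *)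
  pcom_pi : hom (pcom_obj ⊗ H) pcom_bullet;
  pcom_rho : hom pcom_obj pcom_bullet;
  pcom_pi_epi : epi pcom_pi
}.

Section Geometric.
Variable X : partial_comodule_datum.

Let XH : C := pcom_bullet X.
Let pi : hom (X ⊗ H) XH := pcom_pi X.
Let rho : hom X XH := pcom_rho X.

Definition pcom_counital : Prop :=
  exists Xeps : hom XH X,
    Xeps ∘ rho = idm X /\ Xeps ∘ pi = runit X ∘ (idm X ⊠ counit H).

Definition pcom_pi_comul : hom (X ⊗ H) (XH ⊗ H) :=
  (pi ⊠ idm H) ∘ assocV X H H ∘ (idm X ⊠ comul H).

(* [P] is (X • H) • H with legs ρ • H and π_(X • H); [Q] is X • (H • H) with
   legs X • Δ and π_(X,Δ).  By uniqueness of pushouts up to isomorphism the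
   condition does not depend on the choice of [P] and [Q]; asking for their
   existence keeps it from being vacuous. *)
Definition pcom_coassociative : Prop :=
  exists (P : pushout pi (rho ⊠ idm H)) (Q : pushout pi pcom_pi_comul)
         (theta : hom Q P),
    [/\ iso theta,
        theta ∘ po_inr Q = po_inr P &
        theta ∘ po_inl Q ∘ rho = po_inl P ∘ rho].

End Geometric.

Record geometric_partial_comodule := GeometricPartialComodule {
  gpc_datum :> partial_comodule_datum;
  gpc_counital : pcom_counital gpc_datum;
  gpc_coassociative : pcom_coassociative gpc_datum
}.

Definition compatible (X : partial_comodule_datum) (Z : comodule)
    (f : hom Z X) : Prop :=
  pcom_rho X ∘ f = pcom_pi X ∘ (f ⊠ idm H) ∘ coact Z.

Record is_globalization (X : partial_comodule_datum) (Y : comodule)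
    (p : hom Y X) : Prop := IsGlobalization {
  glob_compatible : compatible p;
  glob_universal : forall Z : comodule,
    set_bij [set eta : hom Z Y | is_comodule_mor eta]
            [set f : hom Z X | compatible f]
            (fun eta : hom Z Y => p ∘ eta);
  glob_pushout :
    is_pushout p ((p ⊠ idm H) ∘ coact Y) (pcom_rho X) (pcom_pi X)
}.

Definition globalizable (X : geometric_partial_comodule) : Prop :=
  exists (Y : comodule) (p : hom Y X), is_globalization p.

End Comodules.

(* Main.v *)
Require Import Defs.
From mathcomp Require Import all_boot ssralg.
From mathcomp Require Import classical_sets functions.

(** The globalization is an equalizer of comodules. The cofree comodule
    [X ⊗ H] carries two comodule morphisms to [(X • H) ⊗ H], namely
    [a = ρ ⊗ H] and [b = (π ⊗ H) ∘ (X ⊗ Δ)]. Morphisms [Z -> X] out of a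
    comodule [Z] are the same thing as comodule morphisms [Z -> X ⊗ H]
    ([cofree_liftK], [cofree_counitK]), and under this bijection [f] satisfies
    [ρ ∘ f = π ∘ (f ⊗ H) ∘ δ] exactly when its lift equalizes [a] and [b]
    ([compatible_lift]). Left flatness makes the equalizer [k : Y -> X ⊗ H] of
    [a] and [b] in the base category a comodule equalizer
    ([comodule_equalizer]), so [Y], with [p = (X ⊗ ε) ∘ k], is universal among
    comodules with a compatible morphism to [X].

    The geometric axioms enter through the pushout condition. Since [(p ⊗ H)
    ∘ δ = k], the square to study is [π ∘ k = ρ ∘ p], and as [π] is epi it
    suffices that this square be a pullback ([pullback_epi_pushout]). As [k]
    is the equalizer of [a] and [b] and [ρ] is mono, that amounts to: [π z =
    ρ x] implies [a z = b z] ([pcom_pullback_equalizes]). Geometric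
    coassociativity says that [a z] and [b z] have the same image in [(X •
    H) • H]; the difference of [a z] and [b z] is thus [a c] for some [c] in
    the kernel of [π] ([pushout_kernel]). Counitality provides a common
    retraction [r = (X • ε) ⊗ H] of [a] and [b], and applying [r] to [a z -
    b z = a c] gives [c = 0]. *)

Set Implicit Arguments.
Unset Strict Implicit.
Unset Printing Implicit Defensive.

Import GRing.Theory.
Local Open Scope cat_scope.

(** * Preadditive and abelian categories *)

Section Preadditive.
Variables (C : category) (A : preadditive C).

Definition sub_mor (x y : C) (f g : hom x y) : hom x y :=
  ((f : hom_zmod A x y) - (g : hom_zmod A x y))%R.

Lemma zero_compm (x y z : C) (h : hom x y) :
  zero_mor A y z ∘ h = zero_mor A x z.
Proof.
have := compmDl (p := A) (0 : hom_zmod A y z)%R 0%R h; rewrite addr0.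
move=> /(congr1 (fun t => sub_mor t (zero_mor A y z ∘ h))).
by rewrite /sub_mor addrK subrr.
Qed.

Lemma compm_zero (x y z : C) (f : hom y z) :
  f ∘ zero_mor A x y = zero_mor A x z.
Proof.
have := compmDr (p := A) f (0 : hom_zmod A x y)%R 0%R; rewrite addr0.
move=> /(congr1 (fun t => sub_mor t (f ∘ zero_mor A x y))).
by rewrite /sub_mor addrK subrr.
Qed.

Lemma sub_compm (x y z : C) (f g : hom y z) (h : hom x y) :
  sub_mor f g ∘ h = sub_mor (f ∘ h) (g ∘ h).
Proof.
have := compmDl (p := A) (sub_mor f g) g h; rewrite {1}/sub_mor subrK => ->.
by rewrite /sub_mor addrK.
Qed.

Lemma compm_sub (x y z : C) (f : hom y z) (g h : hom x y) :
  f ∘ sub_mor g h = sub_mor (f ∘ g) (f ∘ h).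
Proof.
have := compmDr (p := A) f (sub_mor g h) h; rewrite {1}/sub_mor subrK => ->.
by rewrite /sub_mor addrK.
Qed.

Lemma sub_mor_eq0 (x y : C) (f g : hom x y) :
  sub_mor f g = zero_mor A x y <-> f = g.
Proof.
split=> [fg0 | ->]; first exact: (@subr0_eq (hom_zmod A x y)).
exact: (@subrr (hom_zmod A x y)).
Qed.

Lemma sub_mor0 (x y : C) (f : hom x y) : sub_mor f (zero_mor A x y) = f.
Proof. exact: (@subr0 (hom_zmod A x y)). Qed.

Lemma sub_morrI (x y : C) (f g h : hom x y) :
  sub_mor f g = sub_mor f h -> g = h.
Proof.
move=> fgh; apply: (@oppr_inj (hom_zmod A x y)).
exact: (@addrI (hom_zmod A x y) f).
Qed.

Lemma sub_mor_kernel (x y : C) (f g : hom x y) (e : C) (k : hom e x) :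
  is_kernel A (sub_mor f g) k -> is_equalizer f g k.
Proof.
move=> [k0 kU]; split.
  by apply/sub_mor_eq0; rewrite -sub_compm k0 zero_compm.
move=> t u fgu; apply: kU.
by rewrite zero_compm sub_compm; apply/sub_mor_eq0.
Qed.

End Preadditive.

Lemma equalizer_mono (C : category) (x y : C) (f g : hom x y) (e : C)
    (k : hom e x) : is_equalizer f g k -> mono k.
Proof.
move=> [fgk kU] z u v kuv.
have [|w [_ wU]] := kU z (k ∘ u); first by rewrite !compmA fgk.
by rewrite -(wU u) // -(wU v).
Qed.

Section Abelian.
Variables (C : category) (abC : abelian C).
Let zero := zero_mor abC.
Let sub := @sub_mor C abC.

Lemma abelian_equalizer (x y : C) (f g : hom x y) :
  exists (e : C) (k : hom e x), is_equalizer f g k.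
Proof.
have [e [k kP]] := abelian_kernel abC (sub f g).
by exists e, k; apply: sub_mor_kernel kP.
Qed.

(** Pushing out an epimorphism along a monomorphism does not enlarge its
    kernel. With [k] the kernel of [f], the monomorphism [g ∘ k] is itself the
    kernel of some [h]; this [h] extends to the pushout, so it vanishes on
    every [a] killed by [j], which therefore factors through [g ∘ k]. *)
Lemma pushout_kernel (s x y q : C) (f : hom s x) (g : hom s y)
    (i : hom x q) (j : hom y q) (t : C) (a : hom t y) :
  epi f -> mono g -> is_pushout f g i j -> j ∘ a = zero t q ->
  exists2 b : hom t s, g ∘ b = a & f ∘ b = zero t x.
Proof.
move=> fepi gmono [_ poU] ja0.
have [k0 [k [fk kU]]] := abelian_kernel abC f.
rewrite zero_compm in fk.
have gk_mono : mono (g ∘ k).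
  move=> z u v; rewrite -!compmA => /gmono.
  by apply: equalizer_mono; split=> [|t' u' /kU//]; rewrite fk zero_compm.
have [r [h [hgk hU]]] := abelian_mono abC gk_mono.
rewrite zero_compm compmA in hgk.
have [c [l [fl lU]]] := abelian_epi abC fepi; rewrite compm_zero in fl.
have [|m [ml _]] := kU c l; first by rewrite fl zero_compm.
(* [h ∘ g] vanishes on the kernel of [f], hence extends along [f]; together
   with [h] the extension is a cocone under the pushout. *)
have [|w [wf _]] := lU _ (h ∘ g).
  by rewrite compm_zero -ml compmA hgk zero_compm.
have [w' [[_ w'j] _]] := poU _ w h wf.
have [|b [bP _]] := hU t a.
  by rewrite zero_compm -w'j -compmA ja0 compm_zero.
exists (k ∘ b); first by rewrite compmA.
by rewrite compmA fk zero_compm.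
Qed.

(** The pullback property says that [z] maps onto the kernel of the difference
    [d : x ⊕ y -> q] of [f ∘ q1] and [g ∘ q2]; as [f] is epi, so is [d], which
    is thus the cokernel of its kernel. That is the pushout property. *)
Lemma pullback_epi_pushout (x y z q : C) (f : hom x q) (g : hom y q)
    (p1 : hom z x) (p2 : hom z y) :
  epi f -> f ∘ p1 = g ∘ p2 ->
  (forall t (a : hom t x) (b : hom t y), f ∘ a = g ∘ b ->
     exists2 c : hom t z, p1 ∘ c = a & p2 ∘ c = b) ->
  is_pushout p2 p1 g f.
Proof.
move=> fepi sq pb; split=> // t u v uv.
have [w [i1 [i2 [q1 [q2 [q1i1 q2i2 q1i2 q2i1 _]]]]]] := abelian_biproduct abC x y.
have cop_i1 s (l : hom x s) (m : hom y s) : sub (l ∘ q1) (m ∘ q2) ∘ i1 = l.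
  by rewrite sub_compm -!compmA q1i1 q2i1 compm1r compm_zero sub_mor0.
have cop_i2 s (l : hom x s) (m : hom y s) :
    sub (l ∘ q1) (m ∘ q2) ∘ i2 = sub (zero y s) m.
  by rewrite sub_compm -!compmA q1i2 q2i2 compm1r compm_zero.
pose d := sub (f ∘ q1) (g ∘ q2).
have depi : epi d.
  move=> s l m /(congr1 (fun n => n ∘ i1)).
  by rewrite -!compmA cop_i1; apply: fepi.
have [n [r [dr dU]]] := abelian_epi abC depi; rewrite compm_zero in dr.
have [c c1 c2] : exists2 c : hom n z, p1 ∘ c = q1 ∘ r & p2 ∘ c = q2 ∘ r.
  apply: pb; rewrite !compmA; apply/(@sub_mor_eq0 _ abC).
  by rewrite -sub_compm.
have [|e [ed _]] := dU _ (sub (v ∘ q1) (u ∘ q2)).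
  rewrite compm_zero sub_compm; apply/sub_mor_eq0.
  by rewrite -!compmA -c1 -c2 !compmA uv.
have ef : e ∘ f = v by rewrite -(cop_i1 _ f g) compmA ed cop_i1.
exists e; split=> [|e' [_ e'f]]; last by apply: fepi; rewrite ef e'f.
split=> //.
(* On the summand [y] the equation [ed] reads [0 - e ∘ g = 0 - u]. *)
apply: (@sub_morrI _ abC _ _ (zero y t)).
rewrite -[RHS](cop_i2 _ v) -ed -compmA cop_i2 compm_sub; congr sub_mor.
by rewrite compm_zero.
Qed.

End Abelian.

(** * Monoidal coherence *)

Section Monoidal.
Variable C : monoidal_category.
Implicit Types x y z : C.

Lemma tensm_compl x y z w (f : hom y z) (g : hom x y) :
  (f ∘ g) ⊠ idm w = (f ⊠ idm w) ∘ (g ⊠ idm w).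
Proof. by rewrite -tensm_comp compm1l. Qed.

Lemma tensm_compr x y z w (f : hom y z) (g : hom x y) :
  idm w ⊠ (f ∘ g) = (idm w ⊠ f) ∘ (idm w ⊠ g).
Proof. by rewrite -tensm_comp compm1l. Qed.

Lemma tensm_interchange x x' y y' (f : hom x x') (g : hom y y') :
  (f ⊠ idm y') ∘ (idm x ⊠ g) = (idm x' ⊠ g) ∘ (f ⊠ idm y).
Proof. by rewrite -!tensm_comp !compm1l !compm1r. Qed.

Lemma assoc_inj w x y z (f g : hom w (x ⊗ y ⊗ z)) :
  assoc x y z ∘ f = assoc x y z ∘ g -> f = g.
Proof.
by move=> /(congr1 (compm (assocV x y z))); rewrite !compmA assocK !compm1l.
Qed.

Lemma assocV_nat x x' y y' z z' (f : hom x x') (g : hom y y') (h : hom z z') :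
  assocV x' y' z' ∘ (f ⊠ (g ⊠ h)) = ((f ⊠ g) ⊠ h) ∘ assocV x y z.
Proof.
apply: assoc_inj; rewrite !compmA assocVK compm1l assoc_nat -compmA.
by rewrite assocVK compm1r.
Qed.

Lemma tens_unit_inj x y (f g : hom x y) :
  f ⊠ idm unit_obj = g ⊠ idm unit_obj -> f = g.
Proof.
move=> fg; have [r [_ rK]] := runit_iso x.
by rewrite -[f]compm1r -[g]compm1r -rK !compmA -!runit_nat fg.
Qed.

(** Kelly's derivation from the pentagon and the triangle. Tensoring with the
    unit is faithful, so it suffices to compare both sides after [- ⊗ unit],
    where the pentagon at [(x, y, unit, unit)] relates them. *)
Lemma runit_tens x y :
  runit (x ⊗ y) = (idm x ⊠ runit y) ∘ assoc x y unit_obj.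
Proof.
apply: tens_unit_inj; apply: assoc_inj.
rewrite tensm_compl compmA assoc_nat -!triangle tensm_compr.
have := congr1 (compm (idm x ⊠ (idm y ⊠ lunit unit_obj)))
  (pentagon x y unit_obj unit_obj).
by rewrite !compmA -assoc_nat tensm1 => ->.
Qed.

End Monoidal.

(** * Cofree comodules *)

Section Cofree.
Variables (C : monoidal_category) (H : coalgebra C).

Definition cofree_coact (x : C) : hom (x ⊗ H) (x ⊗ H ⊗ H) :=
  assocV x H H ∘ (idm x ⊠ comul H).

Lemma assoc_cofree_coact (x : C) :
  assoc x H H ∘ cofree_coact x = idm x ⊠ comul H.
Proof. by rewrite compmA assocVK compm1l. Qed.

(** After the associator at [(x, H, H ⊗ H)], the pentagon turns both sides into
    [x] tensored with the two sides of the coassociativity of [H]. *)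
Lemma cofree_coactA (x : C) :
  assoc _ _ _ ∘ (cofree_coact x ⊠ idm H) ∘ cofree_coact x
  = (idm (x ⊗ H) ⊠ comul H) ∘ cofree_coact x.
Proof.
apply: assoc_inj.
rewrite [RHS]compmA -tensm1 [X in _ = X ∘ _]assoc_nat -[RHS]compmA.
rewrite assoc_cofree_coact -tensm_compr.
rewrite -comulA !tensm_compr !compmA -pentagon.
rewrite -[_ ∘ (assoc x H H ⊠ _) ∘ _]compmA -tensm_compl assoc_cofree_coact.
by rewrite -[_ ∘ assoc _ _ _ ∘ _]compmA assoc_nat -!compmA assoc_cofree_coact.
Qed.

Lemma cofree_coact_counit (x : C) :
  runit _ ∘ (idm (x ⊗ H) ⊠ counit H) ∘ cofree_coact x = idm (x ⊗ H).
Proof.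
rewrite runit_tens -tensm1 -[_ ∘ assoc _ _ _ ∘ _]compmA assoc_nat -!compmA.
by rewrite assoc_cofree_coact -!tensm_compr compmA counitr tensm1.
Qed.

Definition cofree (x : C) : comodule H :=
  Comodule (cofree_coactA x) (cofree_coact_counit x).

Definition cofree_counit (x : C) : hom (cofree x) x :=
  runit x ∘ (idm x ⊠ counit H).

(** [cofree_lift] and composition with [cofree_counit] are the two directions
    of the adjunction between the forgetful functor and [cofree]. *)
Definition cofree_lift (Z : comodule H) (x : C) (f : hom Z x) :
    hom Z (cofree x) := (f ⊠ idm H) ∘ coact Z.

Lemma tens_cofree_mor (x y : C) (f : hom x y) :
  @is_comodule_mor C H (cofree x) (cofree y) (f ⊠ idm H).
Proof.
rewrite /is_comodule_mor /= /cofree_coact -compmA -tensm_interchange.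
by rewrite !compmA -[idm (H ⊗ H)]tensm1 assocV_nat.
Qed.

Lemma comodule_mor_comp (M N P : comodule H) (g : hom N P) (f : hom M N) :
  is_comodule_mor g -> is_comodule_mor f ->
  @is_comodule_mor C H M P (g ∘ f).
Proof.
move=> gP fP; rewrite /is_comodule_mor compmA gP -compmA fP compmA.
by rewrite -tensm_compl.
Qed.

(** Coassociativity of [Z], seen as a map into the cofree comodule on [Z]. *)
Lemma coact_mor (Z : comodule H) : @is_comodule_mor C H Z (cofree Z) (coact Z).
Proof.
apply: assoc_inj; rewrite compmA assoc_cofree_coact.
by rewrite compmA coactA.
Qed.

Lemma cofree_lift_mor (Z : comodule H) (x : C) (f : hom Z x) :
  is_comodule_mor (cofree_lift f).
Proof.
apply: (@comodule_mor_comp Z (cofree Z)); first exact: tens_cofree_mor.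
exact: coact_mor.
Qed.

Lemma cofree_liftK (Z : comodule H) (x : C) (f : hom Z x) :
  cofree_counit x ∘ cofree_lift f = f.
Proof.
rewrite /cofree_counit /cofree_lift compmA -[_ ∘ (f ⊠ _)]compmA.
by rewrite -tensm_interchange compmA runit_nat -!compmA [X in f ∘ X]compmA
  coact_counit compm1r.
Qed.

Lemma cofree_lift_inj (Z : comodule H) (x : C) (f g : hom Z x) :
  cofree_lift f = cofree_lift g -> f = g.
Proof. by move=> fg; rewrite -(cofree_liftK f) fg cofree_liftK. Qed.

Lemma cofree_lift_comp (Z M : comodule H) (x : C) (f : hom M x) (g : hom Z M) :
  is_comodule_mor g -> cofree_lift (f ∘ g) = cofree_lift f ∘ g.
Proof.
by move=> gP; rewrite /cofree_lift tensm_compl -!compmA gP.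
Qed.

Lemma tens_cofree_lift (Z : comodule H) (x y : C) (f : hom x y) (g : hom Z x) :
  (f ⊠ idm H) ∘ cofree_lift g = cofree_lift (f ∘ g).
Proof. by rewrite /cofree_lift tensm_compl compmA. Qed.

(** The triangle moves [runit x ⊠ idm H] over to [lunit H], which reduces the
    claim to the left counit law of [H]. *)
Lemma cofree_lift_counit (x : C) :
  cofree_lift (cofree_counit x) = idm (x ⊗ H).
Proof.
rewrite /cofree_lift /cofree_counit tensm_compl -triangle -!compmA.
rewrite [assoc _ _ _ ∘ _]compmA assoc_nat -compmA assoc_cofree_coact.
by rewrite -!tensm_compr compmA counitl tensm1.
Qed.

Lemma cofree_counitK (Z : comodule H) (x : C) (g : hom Z (cofree x)) :
  is_comodule_mor g -> cofree_lift (cofree_counit x ∘ g) = g.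
Proof. by move=> gP; rewrite cofree_lift_comp // cofree_lift_counit compm1l. Qed.

End Cofree.

(** * Equalizers of comodules *)

Section ComoduleEqualizer.
Variables (C : monoidal_category) (H : coalgebra C) (flatH : left_flat H).

Lemma comodule_mor_factor (E M Z : comodule H) (k : hom E M) (f : hom Z E) :
  mono (k ⊠ idm H) -> is_comodule_mor k ->
  @is_comodule_mor C H Z M (k ∘ f) -> is_comodule_mor f.
Proof.
move=> kmono kP; rewrite /is_comodule_mor => kfP; apply: kmono.
by rewrite compmA -kP -compmA kfP tensm_compl compmA.
Qed.

(** Flatness is used twice: [k ⊠ idm H] is an equalizer, which produces the
    coaction, and [(k ⊠ idm H) ⊠ idm H] is then an equalizer too, hence a
    monomorphism, along which coassociativity is inherited from [M]. *)
Lemma comodule_equalizer (M N : comodule H) (f g : hom M N) (e : C)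
    (k : hom e M) :
  is_comodule_mor f -> is_comodule_mor g -> is_equalizer f g k ->
  exists (E : comodule H) (l : hom E M),
    is_equalizer f g l /\ is_comodule_mor l.
Proof.
move=> fP gP kE; have kHE := flatH kE.
have kmono := equalizer_mono kE.
have kHHmono := equalizer_mono (flatH kHE).
have [|d [kd _]] := kHE.2 e (coact M ∘ k).
  by rewrite !compmA -fP -gP -!compmA kE.1.
have dA : assoc _ _ _ ∘ (d ⊠ idm H) ∘ d = (idm e ⊠ comul H) ∘ d.
  have aVI : assocV _ _ _ ∘ ((idm e ⊠ comul H) ∘ d) = (d ⊠ idm H) ∘ d.
    apply: kHHmono; rewrite !compmA -assocV_nat -tensm_compl kd tensm1.
    rewrite -[_ ∘ (k ⊠ _) ∘ _]compmA tensm_interchange.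
    rewrite tensm_compl -!compmA kd [_ ∘ (coact M ∘ k)]compmA -coactA !compmA.
    by rewrite assocK compm1l.
  by rewrite -compmA -aVI compmA assocVK compm1l.
have d1 : runit _ ∘ (idm e ⊠ counit H) ∘ d = idm e.
  apply: kmono; rewrite !compmA -runit_nat -[_ ∘ (k ⊠ _) ∘ _]compmA.
  by rewrite tensm_interchange -!compmA kd !compmA coact_counit compm1l compm1r.
by exists (Comodule dA d1), k.
Qed.

End ComoduleEqualizer.

(** * Globalization *)

Section Globalization.
Variables (C : monoidal_category) (H : coalgebra C).
Variable X : partial_comodule_datum H.

(** As a lift, this map is a comodule morphism, and its composite with a lift is
    again a lift. *)
Lemma pcom_pi_comulE :
  pcom_pi_comul X = cofree_lift (Z := cofree H X) (pcom_pi X).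
Proof. by rewrite /pcom_pi_comul /cofree_lift /= /cofree_coact compmA. Qed.

(** The two sides are the lifts of [ρ ∘ f] and of [π ∘ cofree_lift f], and
    lifting is injective. *)
Lemma compatible_lift (Z : comodule H) (f : hom Z X) :
  compatible f <->
  (pcom_rho X ⊠ idm H) ∘ cofree_lift f = pcom_pi_comul X ∘ cofree_lift f.
Proof.
rewrite /compatible pcom_pi_comulE tens_cofree_lift.
rewrite -(cofree_lift_comp (M := cofree H X)); last exact: cofree_lift_mor.
by rewrite -compmA; split=> [-> // | /cofree_lift_inj].
Qed.

End Globalization.

(** In terms of elements: [(X • H) • H] identifies [a z] with the image of
    [π z = ρ x], and coassociativity on [x] identifies the latter with the
    image of [b z]. Their difference is thus [a c] with [c] in the kernel of
    [π], and [X • ε] gives a common retraction of [a] and [b], which forces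
    [c = 0]. *)
Lemma pcom_pullback_equalizes (C : monoidal_category) (abC : abelian C)
    (H : coalgebra C) (X : geometric_partial_comodule H) (t : C)
    (z : hom t (X ⊗ H)) (x : hom t X) :
  pcom_pi X ∘ z = pcom_rho X ∘ x ->
  (pcom_rho X ⊠ idm H) ∘ z = pcom_pi_comul X ∘ z.
Proof.
set rho := pcom_rho X; set pi := pcom_pi X => zx.
set a := rho ⊠ idm H; set b := pcom_pi_comul X.
have [ie [ie_rho ie_pi]] := gpc_counital X.
pose r := ie ⊠ idm H.
have ra : r ∘ a = idm (X ⊗ H) by rewrite -tensm_compl ie_rho tensm1.
have rb : r ∘ b = idm (X ⊗ H).
  rewrite /b pcom_pi_comulE (tens_cofree_lift (Z := cofree H X)) ie_pi.
  exact: cofree_lift_counit.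
have a_mono : mono a.
  by move=> s u v /(congr1 (compm r)); rewrite !compmA ra !compm1l.
have [P [Q [theta [_ thr thl]]]] := gpc_coassociative X.
have Pa : po_inr P ∘ a = po_inl P ∘ pi := esym (pushoutP P).1.
have Qb : po_inr Q ∘ b = po_inl Q ∘ pi := esym (pushoutP Q).1.
have Pab : po_inr P ∘ (a ∘ z) = po_inr P ∘ (b ∘ z).
  transitivity (theta ∘ po_inl Q ∘ rho ∘ x).
    by rewrite compmA Pa -compmA zx compmA thl.
  by rewrite -thr -!compmA -zx (compmA (po_inl Q)) -Qb -!compmA.
have [|c ac _] := pushout_kernel (abC := abC) (a := sub_mor abC (a ∘ z) (b ∘ z))
   (@pcom_pi_epi _ _ X) a_mono (pushoutP P).
  by rewrite compm_sub; apply/sub_mor_eq0.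
apply/(@sub_mor_eq0 _ abC); rewrite -ac.
have -> : c = zero_mor abC _ _.
  rewrite -[c]compm1l -ra -compmA ac compm_sub (compmA r a) (compmA r b) ra rb.
  by apply/sub_mor_eq0.
exact: compm_zero.
Qed.

Theorem theorem3p5 (C : monoidal_category) (abC : abelian C)
    (H : coalgebra C) (flatH : left_flat H)
    (X : geometric_partial_comodule H) :
  globalizable X.
Proof.
set rho := pcom_rho X; set pi := pcom_pi X.
have pi_epi : epi pi := @pcom_pi_epi _ _ X.
pose a := rho ⊠ idm H : hom (cofree H X) (cofree H (pcom_bullet X)).
pose b := pcom_pi_comul X : hom (cofree H X) (cofree H (pcom_bullet X)).
have aP : is_comodule_mor a by exact: tens_cofree_mor.
have bP : is_comodule_mor b.
  by rewrite /b pcom_pi_comulE; apply: cofree_lift_mor.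
have [e [k0 k0E]] := abelian_equalizer abC a b.
have [Y [k [kE kP]]] := comodule_equalizer flatH aP bP k0E.
have kmono := equalizer_mono kE.
have kHmono := equalizer_mono (flatH _ _ _ _ _ _ kE).
pose p : hom Y X := cofree_counit H X ∘ k.
have pE : cofree_lift p = k by apply: cofree_counitK.
have pC : compatible p by apply/compatible_lift; rewrite pE kE.1.
exists Y, p; split=> //.
- move=> Z; split.
  + move=> f /= fP; apply/compatible_lift; rewrite (cofree_lift_comp p fP) pE.
    by rewrite !compmA kE.1.
  + move=> f g; rewrite !inE /= => fP gP fg; apply: kmono.
    by rewrite -pE -(cofree_lift_comp p fP) -(cofree_lift_comp p gP) fg.
  + move=> f /= /compatible_lift /(kE.2) [g [kg _]].
    exists g; last by rewrite /p -compmA kg cofree_liftK.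
    apply: (comodule_mor_factor kHmono kP); rewrite kg.
    exact: cofree_lift_mor.
- have [ie [ie_rho _]] := gpc_counital X.
  have rho_mono : mono rho.
    by move=> t u v /(congr1 (compm ie)); rewrite !compmA ie_rho !compm1l.
  have sq : pi ∘ k = rho ∘ p by rewrite pC -compmA -/(cofree_lift p) pE.
  rewrite -/(cofree_lift p) pE.
  apply: (pullback_epi_pushout abC pi_epi sq) => t z x zx.
  have [y [ky _]] := kE.2 t z (pcom_pullback_equalizes abC zx).
  exists y => //; apply: rho_mono.
  by rewrite compmA -sq -compmA ky zx.
Qed.
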